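(* Let $a,b,d\in\mathbb{H}_s$ and let $A=\begin{pmatrix} a&b\\ 0&d\end{pmatrix}\in \mathbb{H}_s^{2\times 2}$. Then the following hold. (1) If $S_L(d-a,b)\neq\emptyset$, then $d\in\sigma_l(A)$ and $(x,1)^T\in V_l(d)$ for all $x\in S_L(d-a,b)$. (2) We have $0\in S_Q(b,a-d,0)$ (so $S_Q(b,a-d,0)\neq\emptyset$), and for every $x\in S_Q(b,a-d,0)$, setting $\lambda=a+bx$, we have $\lambda\in\sigma_l(A)$ and $(1,x)^T\in V_l(\lambda)$. (3) In particular, $a\in\sigma_l(A)$, and $(1,x)^T\in V_l(a)$ for all $x\in S_L(b,0)\cap S_L(a-d,0)$. Moreover, $d\in\sigma_l(A)$ if and only if $S_L(d-a,b)\cup S_L(b,d-a)\neq\emptyset$. In this case, $d\in\sigma_l(A)$ with eigenvectors $v=(x,1)^T$ for all $x\in S_L(d-a,b)$ (provided $S_L(d-a,b)\neq\emptyset$) and $v=(1,x)^T$ for all $x\in S_L(b,d-a)$ (provided $S_L(b,d-a)\neq\emptyset$).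
   Context: $\mathbb{H}_s$ denotes the split quaternion algebra: the associative real algebra with basis $1,\mathbf{i},\mathbf{j},\mathbf{k}$, unit $1$, and multiplication $\mathbf{i}^2=-1$, $\mathbf{j}^2=\mathbf{k}^2=1$, $\mathbf{i}\mathbf{j}=-\mathbf{j}\mathbf{i}=\mathbf{k}$, $\mathbf{j}\mathbf{k}=-\mathbf{k}\mathbf{j}=-\mathbf{i}$, $\mathbf{k}\mathbf{i}=-\mathbf{i}\mathbf{k}=\mathbf{j}$. For $x=x_0+x_1\mathbf{i}+x_2\mathbf{j}+x_3\mathbf{k}$ with $x_i\in\mathbb{R}$, put $\bar x=x_0-x_1\mathbf{i}-x_2\mathbf{j}-x_3\mathbf{k}$ and $I_x=\bar x x=x\bar x=x_0^2+x_1^2-x_2^2-x_3^2$. Let $Z(\mathbb{H}_s)=\{x\in\mathbb{H}_s: I_x=0\}$; this is the set of noninvertible elements (it contains $0$). Left eigenvalues: for $A\in\mathbb{H}_s^{n\times n}$, an element $\lambda\in\mathbb{H}_s$ is a left eigenvalue of $A$ if there is $x\in\mathbb{H}_s^n$ with $x\notin Z(\mathbb{H}_s)^n$ (i.e. at least one component of $x$ is invertible) such that $Ax=\lambda x$, where $\lambda x$ is componentwise left multiplication. The set of left eigenvalues of $A$ is the left spectrum $\sigma_l(A)$. For $\lambda\in\sigma_l(A)$, $V_l(\lambda)=\{x\in\mathbb{H}_s^n: Ax=\lambda x\}$. An eigenvector for $\lambda$ is an $x\in V_l(\lambda)$ with $x\notin Z(\mathbb{H}_s)^n$. Solution sets: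 for $p,q,r\in\mathbb{H}_s$, $S_L(p,q)=\{x\in\mathbb{H}_s: px=q\}$ and $S_Q(p,q,r)=\{x\in\mathbb{H}_s: px^2+qx+r=0\}$ (with $p=0$ allowed). *)

(* Defs.v *)
From HB Require Import structures.
From mathcomp Require Import all_boot all_order all_algebra.
From mathcomp Require Import ring.
From mathcomp Require Import boolp classical_sets reals.

Set Implicit Arguments.
Unset Strict Implicit.
Unset Printing Implicit Defensive.

Import GRing.Theory.

Local Open Scope ring_scope.
Local Open Scope classical_set_scope.

(* [SplitQuat x0 x1 x2 x3] is x0 + x1 i + x2 j + x3 k; see [sq_basis]. *)
Record splitquat (R : realType) :=
  SplitQuat { sq0 : R; sq1 : R; sq2 : R; sq3 : R }.

Definition sq_to_tuple (R : realType) (x : splitquat R) : R * R * R * R :=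
  (sq0 x, sq1 x, sq2 x, sq3 x).

Definition sq_of_tuple (R : realType) (t : R * R * R * R) : splitquat R :=
  let: (x0, x1, x2, x3) := t in SplitQuat x0 x1 x2 x3.

Lemma sq_to_tupleK (R : realType) :
  cancel (@sq_to_tuple R) (@sq_of_tuple R).
Proof. by case. Qed.

HB.instance Definition _ (R : realType) :=
  Choice.copy (splitquat R) (can_type (@sq_to_tupleK R)).

Definition sq_add (R : realType) (x y : splitquat R) : splitquat R :=
  let: SplitQuat x0 x1 x2 x3 := x in
  let: SplitQuat y0 y1 y2 y3 := y in
  SplitQuat (x0 + y0) (x1 + y1) (x2 + y2) (x3 + y3).

Definition sq_opp (R : realType) (x : splitquat R) : splitquat R :=
  let: SplitQuat x0 x1 x2 x3 := x in SplitQuat (- x0) (- x1) (- x2) (- x3).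

Definition sq_scale (R : realType) (c : R) (x : splitquat R) : splitquat R :=
  let: SplitQuat x0 x1 x2 x3 := x in
  SplitQuat (c * x0) (c * x1) (c * x2) (c * x3).

(* Bilinear extension of i^2 = -1, j^2 = k^2 = 1, ij = -ji = k,
   jk = -kj = -i, ki = -ik = j; see [sq_mul_table]. *)
Definition sq_mul (R : realType) (x y : splitquat R) : splitquat R :=
  let: SplitQuat x0 x1 x2 x3 := x in
  let: SplitQuat y0 y1 y2 y3 := y in
  SplitQuat (x0 * y0 - x1 * y1 + x2 * y2 + x3 * y3)
            (x0 * y1 + x1 * y0 - x2 * y3 + x3 * y2)
            (x0 * y2 + x2 * y0 - x1 * y3 + x3 * y1)
            (x0 * y3 + x3 * y0 + x1 * y2 - x2 * y1).

Lemma sq_addA (R : realType) : associative (@sq_add R).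
Proof. by move=> [????] [????] [????] /=; congr SplitQuat; ring. Qed.

Lemma sq_addC (R : realType) : commutative (@sq_add R).
Proof. by move=> [????] [????] /=; congr SplitQuat; ring. Qed.

Lemma sq_add0 (R : realType) : left_id (SplitQuat 0 0 0 0) (@sq_add R).
Proof. by move=> [????] /=; congr SplitQuat; ring. Qed.

Lemma sq_addN (R : realType) :
  left_inverse (SplitQuat 0 0 0 0) (@sq_opp R) (@sq_add R).
Proof. by move=> [????] /=; congr SplitQuat; ring. Qed.

HB.instance Definition _ (R : realType) :=
  GRing.isZmodule.Build (splitquat R)
    (@sq_addA R) (@sq_addC R) (@sq_add0 R) (@sq_addN R).

Lemma sq_mulA (R : realType) : associative (@sq_mul R).
Proof. by move=> [????] [????] [????] /=; congr SplitQuat; ring. Qed.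

Lemma sq_mul1l (R : realType) : left_id (SplitQuat 1 0 0 0) (@sq_mul R).
Proof. by move=> [????] /=; congr SplitQuat; ring. Qed.

Lemma sq_mul1r (R : realType) : right_id (SplitQuat 1 0 0 0) (@sq_mul R).
Proof. by move=> [????] /=; congr SplitQuat; ring. Qed.

Lemma sq_mulDl (R : realType) :
  left_distributive (@sq_mul R) (@GRing.add (splitquat R)).
Proof.
by move=> [????] [????] [????]; rewrite /GRing.add /=; congr SplitQuat; ring.
Qed.

Lemma sq_mulDr (R : realType) :
  right_distributive (@sq_mul R) (@GRing.add (splitquat R)).
Proof.
by move=> [????] [????] [????]; rewrite /GRing.add /=; congr SplitQuat; ring.
Qed.

Lemma sq_1neq0 (R : realType) :
  SplitQuat 1 0 0 0 != 0 :> splitquat R.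
Proof. by apply/eqP => -[] /eqP; rewrite oner_eq0. Qed.

HB.instance Definition _ (R : realType) :=
  GRing.Zmodule_isNzRing.Build (splitquat R)
    (@sq_mulA R) (@sq_mul1l R) (@sq_mul1r R) (@sq_mulDl R) (@sq_mulDr R)
    (sq_1neq0 R).

Lemma sq_scaleA (R : realType) (c c' : R) (x : splitquat R) :
  sq_scale c (sq_scale c' x) = sq_scale (c * c') x.
Proof. by case: x => ???? /=; congr SplitQuat; ring. Qed.

Lemma sq_scale1 (R : realType) : left_id 1 (@sq_scale R).
Proof. by move=> [????] /=; congr SplitQuat; ring. Qed.

Lemma sq_scaleDr (R : realType) :
  right_distributive (@sq_scale R) (@GRing.add (splitquat R)).
Proof.
by move=> c [????] [????]; rewrite /GRing.add /=; congr SplitQuat; ring.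
Qed.

Lemma sq_scaleDl (R : realType) (x : splitquat R) :
  {morph (@sq_scale R)^~ x : c c' / c + c'}.
Proof.
by case: x => ???? c c'; rewrite {2}/GRing.add /=; congr SplitQuat; ring.
Qed.

HB.instance Definition _ (R : realType) :=
  GRing.Zmodule_isLmodule.Build R (splitquat R)
    (@sq_scaleA R) (@sq_scale1 R) (@sq_scaleDr R) (@sq_scaleDl R).

Lemma sq_scaleAl (R : realType) (c : R) (x y : splitquat R) :
  c *: (x * y) = (c *: x) * y.
Proof.
by case: x y => [????] [????]; rewrite /GRing.scale /GRing.mul /=;
  congr SplitQuat; ring.
Qed.

HB.instance Definition _ (R : realType) :=
  GRing.Lmodule_isLalgebra.Build R (splitquat R) (@sq_scaleAl R).

Lemma sq_scaleAr (R : realType) (c : R) (x y : splitquat R) :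
  c *: (x * y) = x * (c *: y).
Proof.
by case: x y => [????] [????]; rewrite /GRing.scale /GRing.mul /=;
  congr SplitQuat; ring.
Qed.

HB.instance Definition _ (R : realType) :=
  GRing.Lalgebra_isAlgebra.Build R (splitquat R) (@sq_scaleAr R).

Definition sqi (R : realType) : splitquat R := SplitQuat 0 1 0 0.
Definition sqj (R : realType) : splitquat R := SplitQuat 0 0 1 0.
Definition sqk (R : realType) : splitquat R := SplitQuat 0 0 0 1.

Lemma sq_basis (R : realType) (x0 x1 x2 x3 : R) :
  SplitQuat x0 x1 x2 x3 =
  x0%:A + x1 *: sqi R + x2 *: sqj R + x3 *: sqk R.
Proof.
by rewrite /GRing.scale /GRing.one /GRing.add /=; congr SplitQuat; ring.
Qed.

Lemma sq_mul_table (R : realType) (i := sqi R) (j := sqj R) (k := sqk R) :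
  [/\ [/\ i * i = - 1, j * j = 1 & k * k = 1],
      i * j = k /\ j * i = - k,
      j * k = - i /\ k * j = i &
      k * i = j /\ i * k = - j].
Proof.
rewrite /i /j /k /GRing.one /GRing.mul /GRing.opp /=.
by split; split; congr SplitQuat; ring.
Qed.

Definition sq_conj (R : realType) (x : splitquat R) : splitquat R :=
  SplitQuat (sq0 x) (- sq1 x) (- sq2 x) (- sq3 x).

Definition sqI (R : realType) (x : splitquat R) : R :=
  sq0 x ^+ 2 + sq1 x ^+ 2 - sq2 x ^+ 2 - sq3 x ^+ 2.

Lemma sqI_conj (R : realType) (x : splitquat R) :
  sq_conj x * x = (sqI x)%:A /\ x * sq_conj x = (sqI x)%:A.
Proof.
case: x => x0 x1 x2 x3.
rewrite /sqI /sq_conj /GRing.scale /GRing.one /GRing.mul /=.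
by split; congr SplitQuat; ring.
Qed.

Definition sqZ (R : realType) : set (splitquat R) := [set x | sqI x = 0].

Lemma sqI_mul (R : realType) (x y : splitquat R) :
  sqI (x * y) = sqI x * sqI y.
Proof. by case: x y => [????] [????]; rewrite /sqI /=; ring. Qed.

Lemma sqZ_noninvertible (R : realType) (x : splitquat R) :
  sqZ x <-> ~ exists y, y * x = 1 /\ x * y = 1.
Proof.
split=> [/= Ix0 [y [_ xy1]]|Nx].
  have := sqI_mul x y; rewrite xy1 Ix0 mul0r.
  rewrite {1}/sqI /= expr1n expr0n /= addr0 !subr0.
  by move/eqP; rewrite oner_eq0.
apply/eqP; apply: contra_notT Nx => Ix0.
have [cx xc] := sqI_conj x.
exists ((sqI x)^-1 *: sq_conj x).
by rewrite -scalerAl -scalerAr cx xc scalerA mulVf // scale1r.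
Qed.

Definition sqZn (R : realType) (n : nat) : set 'cV[splitquat R]_n :=
  [set x | forall i, sqZ (x i ord0)].

(* Over a noncommutative ring, [lambda *: x] on matrices is the componentwise
   left product [lambda * x i j]. *)
Definition V_l (R : realType) (n : nat) (A : 'M[splitquat R]_n)
    (lambda : splitquat R) : set 'cV[splitquat R]_n :=
  [set x | A *m x = lambda *: x].

Definition left_eigenvector (R : realType) (n : nat) (A : 'M[splitquat R]_n)
    (lambda : splitquat R) (x : 'cV[splitquat R]_n) : Prop :=
  V_l A lambda x /\ ~ sqZn x.

Definition sigma_l (R : realType) (n : nat) (A : 'M[splitquat R]_n) :
    set (splitquat R) :=
  [set lambda | exists x, left_eigenvector A lambda x].

Definition S_L (R : realType) (p q : splitquat R) : set (splitquat R) :=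
  [set x | p * x = q].

Definition S_Q (R : realType) (p q r : splitquat R) : set (splitquat R) :=
  [set x | p * x ^+ 2 + q * x + r = 0].

Definition mx2 (T : Type) (a b c d : T) : 'M[T]_2 :=
  \matrix_(i < 2, j < 2)
    if i == ord0 then (if j == ord0 then a else b)
    else (if j == ord0 then c else d).

Definition cv2 (T : Type) (x y : T) : 'cV[T]_2 :=
  \col_(i < 2) if i == ord0 then x else y.

(* Main.v *)
Require Import Defs.
From mathcomp Require Import all_boot all_order all_algebra.
From mathcomp Require Import boolp classical_sets reals.

Set Implicit Arguments.
Unset Strict Implicit.
Unset Printing Implicit Defensive.

Import GRing.Theory.

Local Open Scope ring_scope.
Local Open Scope classical_set_scope.

(** By [V_l_upper] the eigenvalue equation splits into two equations over the split quaternions. A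
    vector with a component 1 is never in [sqZn], so such a solution is an eigenvector. For [(1, x)]
    the first row forces [lambda = a + b * x], and the second then becomes the quadratic equation
    defining [S_Q]. Conversely, an eigenvector for [d] has an invertible component; [S_L_divr]
    scales it to 1 on the right, leaving a linear equation for the other one. *)

Lemma sqZ1 (R : realType) : ~ sqZ (1 : splitquat R).
Proof. by move=> /sqZ_noninvertible; apply; exists 1; rewrite mulr1. Qed.

(** The zero entry decouples the second row from [x]; at [lambda = d] that row is vacuous and only
    the first constrains the vector. *)
Lemma V_l_upper (R : realType) (a b d lambda x y : splitquat R) :
  V_l (mx2 a b 0 d) lambda (cv2 x y) <->
  a * x + b * y = lambda * x /\ d * y = lambda * y.
Proof.
split=> [/= /colP eqAv|[e0 e1]].
  have := eqAv ord0; have := eqAv ord_max.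
  by rewrite !mxE !big_ord_recl !big_ord0 !mxE /= !addr0 mul0r add0r.
apply/colP => i; rewrite !mxE !big_ord_recl !big_ord0 !mxE /= addr0.
by case: ifP => _ //; rewrite mul0r add0r.
Qed.

Lemma sqZn_cv2 (R : realType) (x y : splitquat R) :
  sqZn (cv2 x y) <-> sqZ x /\ sqZ y.
Proof.
split=> [Zv|[Zx Zy] i]; last by rewrite mxE; case: ifP.
by have := Zv ord0; have := Zv ord_max; rewrite !mxE.
Qed.

Lemma cv2_eta (T : Type) (v : 'cV[T]_2) :
  v = cv2 (v ord0 ord0) (v ord_max ord0).
Proof.
apply/colP => i; rewrite mxE; case: eqP => [-> //|/eqP i0].
by congr (v _ _); apply/val_inj; case: i i0 => [[|[|]]].
Qed.

(* An invertible [y] can be normalized to 1 by right multiplication, which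
   commutes with the left multiplications in the equation. *)
Lemma S_L_divr (R : realType) (p q x y : splitquat R) :
  ~ sqZ y -> p * x = q * y -> S_L p q !=set0.
Proof.
move=> NZy pxqy; have [z [_ yz]] : exists z, z * y = 1 /\ y * z = 1.
  by apply: contrapT => /sqZ_noninvertible.
by exists (x * z); rewrite /S_L /= mulrA pxqy -mulrA yz mulr1.
Qed.

Theorem theorem3p2 (R : realType) (a b d : splitquat R)
    (A : 'M[splitquat R]_2) (hA : A = mx2 a b 0 d) :
  [/\ S_L (d - a) b !=set0 ->
        sigma_l A d /\ (forall x, S_L (d - a) b x -> V_l A d (cv2 x 1)),
      [/\ S_Q b (a - d) 0 0,
          S_Q b (a - d) 0 !=set0 &
          forall x, S_Q b (a - d) 0 x ->
            sigma_l A (a + b * x) /\ V_l A (a + b * x) (cv2 1 x)] &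
      [/\ sigma_l A a,
          forall x, (S_L b 0 `&` S_L (a - d) 0) x -> V_l A a (cv2 1 x),
          sigma_l A d <-> S_L (d - a) b `|` S_L b (d - a) !=set0 &
          sigma_l A d ->
            (forall x, S_L (d - a) b x -> left_eigenvector A d (cv2 x 1)) /\
            (forall x, S_L b (d - a) x -> left_eigenvector A d (cv2 1 x))]].
Proof.
have eigen1r x lambda : V_l A lambda (cv2 x 1) ->
    left_eigenvector A lambda (cv2 x 1).
  by split=> // /sqZn_cv2 [_ /sqZ1].
have eigen1l x lambda : V_l A lambda (cv2 1 x) ->
    left_eigenvector A lambda (cv2 1 x).
  by split=> // /sqZn_cv2 [/sqZ1].
have V_d1r x : S_L (d - a) b x -> V_l A d (cv2 x 1).
  rewrite /S_L /= => dax; rewrite hA; apply/V_l_upper; split=> //.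
  by rewrite mulr1 -dax mulrBl addrC subrK.
have V_d1l x : S_L b (d - a) x -> V_l A d (cv2 1 x).
  rewrite /S_L /= => bx; rewrite hA; apply/V_l_upper; split=> //.
  by rewrite !mulr1 bx addrC subrK.
have V_Q x : S_Q b (a - d) 0 x -> V_l A (a + b * x) (cv2 1 x).
  rewrite /S_Q /= addr0 => Qx; rewrite hA; apply/V_l_upper.
  split; first by rewrite !mulr1.
  (* The difference [(a + b * x) * x - d * x] expands to [b * x ^+ 2 + (a - d) * x]. *)
  apply/esym/eqP; rewrite -subr_eq0 -Qx expr2 mulrA mulrBl mulrDl.
  by rewrite addrAC addrC.
have Q0 : S_Q b (a - d) 0 0 by rewrite /S_Q /= expr0n /= !mulr0 !addr0.
have sigma_d : sigma_l A d <-> S_L (d - a) b `|` S_L b (d - a) !=set0.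
  split=> [[v []]|[x [/V_d1r/eigen1r|/V_d1l/eigen1l]]]; last 2 first.
  - by exists (cv2 x 1).
  - by exists (cv2 1 x).
  rewrite (cv2_eta v); set x := v _ _; set y := v _ _.
  rewrite hA => /V_l_upper [eqx _] NZ.
  have {}eqx : (d - a) * x = b * y by rewrite mulrBl -eqx addrC addKr.
  (* An invertible [x] is divided out to give a point of [S_L b (d - a)]; otherwise [y] must be
     invertible and gives a point of [S_L (d - a) b]. *)
  have [Zx|/S_L_divr NZx] := pselect (sqZ x); last first.
    by have [z] := NZx _ _ _ (esym eqx); exists z; right.
  have NZy : ~ sqZ y by move=> Zy; apply: NZ; apply/sqZn_cv2.
  by have [z] := S_L_divr NZy eqx; exists z; left.
split.
- by case=> x Sx; split=> //; apply/sigma_d; exists x; left.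
- split=> //; first by exists 0.
  by move=> x /V_Q Vx; split=> //; exists (cv2 1 x); apply: eigen1l.
- split=> //.
  (* The root 0 of the quadratic has eigenvalue [a + b * 0 = a]. *)
  + exists (cv2 1 0); apply: eigen1l.
    by have := V_Q _ Q0; rewrite mulr0 addr0.
  (* As [b * x = 0], the eigenvalue [a + b * x] is [a], and [b * x ^+ 2 = (b * x) * x] vanishes. *)
  + move=> x [/= bx adx]; have := V_Q x; rewrite bx addr0; apply.
    by rewrite /S_Q /= expr2 mulrA bx adx mul0r !addr0.
  + by move=> _; split=> x; [move/V_d1r/eigen1r|move/V_d1l/eigen1l].
Qed.
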